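(* Let $\mathrm{EVEN}_n=\{x\in\{0,1\}^n: \sum_{i=1}^n x_i \text{ is even}\}$. Then $\mathrm{rc}(\mathrm{EVEN}_n)=\Theta(2^n)$.
   Context: For $X\subseteq\mathbb{Z}^d$, a polyhedron $R\subseteq\mathbb{R}^d$ is called a relaxation for $X$ if $R\cap\mathbb{Z}^d=\mathrm{conv}(X)\cap\mathbb{Z}^d$. The relaxation complexity $\mathrm{rc}(X)$ is the smallest number of facets of any relaxation for $X$. *)

(* Defs.v *)
(* MathComp-Analysis *)
From HB Require Import structures.
From mathcomp Require Export all_boot all_order all_algebra.
From mathcomp Require Export all_classical all_reals all_analysis.

Set Implicit Arguments.
Unset Strict Implicit.
Unset Printing Implicit Defensive.

Export Order.TTheory GRing.Theory Num.Theory.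
Export numFieldNormedType.Exports.

Local Open Scope classical_set_scope.
Local Open Scope ring_scope.

Definition convex_hull (R : realType) (d : nat) (S : set 'cV[R]_d) :
    set 'cV[R]_d :=
  smallest (@convex_set R 'cV[R]_d) S.

Definition polyhedron (R : realType) (d : nat) (P : set 'cV[R]_d) : Prop :=
  exists (m : nat) (A : 'M[R]_(m, d)) (b : 'cV[R]_m),
    P = [set x : 'cV[R]_d | forall i, (A *m x) i 0 <= b i 0].

Definition affinely_independent (R : realType) (d k : nat)
    (p : 'I_k -> 'cV[R]_d) : Prop :=
  forall l : 'I_k -> R,
    \sum_i l i = 0 -> \sum_i l i *: p i = 0 -> forall i, l i = 0.

(* The maximum number of affinely independent points of S is k + 1; the empty
   set satisfies this for no k. *)
Definition has_dim (R : realType) (d : nat) (S : set 'cV[R]_d) (k : nat) :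
    Prop :=
  (exists p : 'I_k.+1 -> 'cV[R]_d,
     (forall i, S (p i)) /\ affinely_independent p) /\
  (forall (m : nat) (p : 'I_m -> 'cV[R]_d),
     (forall i, S (p i)) -> affinely_independent p -> (m <= k.+1)%N).

(* c = 0 is allowed, so that P is a face of itself. *)
Definition face (R : realType) (d : nat) (P F : set 'cV[R]_d) : Prop :=
  exists (c : 'rV[R]_d) (delta : R),
    (forall x, P x -> (c *m x) 0 0 <= delta) /\
    F = P `&` [set x : 'cV[R]_d | (c *m x) 0 0 = delta].

Definition facet (R : realType) (d : nat) (P F : set 'cV[R]_d) : Prop :=
  face P F /\ exists k : nat, has_dim F k /\ has_dim P k.+1.

Definition integer_points (R : realType) (d : nat) : set 'cV[R]_d :=
  range (map_mx intr : 'cV[int]_d -> 'cV[R]_d).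
Arguments integer_points : clear implicits.

Definition relaxation (R : realType) (d : nat) (X : set 'cV[int]_d)
    (P : set 'cV[R]_d) : Prop :=
  polyhedron P /\
  P `&` integer_points R d =
    convex_hull (map_mx intr @` X) `&` integer_points R d.

(* The infimum is attained as soon as X has a relaxation, and is +oo
   otherwise. *)
Definition rc (R : realType) (d : nat) (X : set 'cV[int]_d) : \bar R :=
  ereal_inf [set (k%:R)%:E | k in
    [set k : nat | exists P : set 'cV[R]_d,
       relaxation X P /\ ([set F | facet P F] #= `I_k)%card]].

Definition EVEN (n : nat) : set 'cV[int]_n :=
  [set x : 'cV[int]_n | (forall i, x i 0 = 0 \/ x i 0 = 1) /\
                      (2 %| \sum_i x i 0)%Z].
Arguments EVEN : clear implicits.

(* Main.v *)
(* Lower bound: if two distinct odd 0/1 points violated the same inequality of a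
   relaxation, so would one of the two even points obtained by flipping in both
   a coordinate where they differ, as this keeps the sum; hence the 2^(n-1) odd
   points violate pairwise distinct inequalities of an irredundant description,
   which are facets since EVEN_n is full-dimensional for n >= 3.
   Upper bound: inside the unit cube, cut off each odd vertex Y by the
   inequality "Hamming distance to Y at least 1". *)
Require Import Defs.
From mathcomp Require Import ring lra zify.

Set Implicit Arguments.
Unset Strict Implicit.
Unset Printing Implicit Defensive.

Local Open Scope classical_set_scope.
Local Open Scope ring_scope.
Local Open Scope convex_scope.

(** * Linear functionals and affine independence *)

Definition dot (R : realType) (d : nat) (c : 'rV[R]_d) (x : 'cV[R]_d) : R :=
  (c *m x) 0 0.

Lemma dotD (R : realType) (d : nat) (c : 'rV[R]_d) (x y : 'cV[R]_d) :
  dot c (x + y) = dot c x + dot c y.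
Proof. by rewrite /dot mulmxDr mxE. Qed.

Lemma dotZ (R : realType) (d : nat) (c : 'rV[R]_d) (a : R) (x : 'cV[R]_d) :
  dot c (a *: x) = a * dot c x.
Proof. by rewrite /dot -scalemxAr mxE. Qed.

Lemma dotB (R : realType) (d : nat) (c : 'rV[R]_d) (x y : 'cV[R]_d) :
  dot c (x - y) = dot c x - dot c y.
Proof. by rewrite -scaleN1r dotD dotZ mulN1r. Qed.

Lemma dot_sum (R : realType) (d : nat) (c : 'rV[R]_d) (I : finType)
    (f : I -> 'cV[R]_d) : dot c (\sum_i f i) = \sum_i dot c (f i).
Proof. by rewrite /dot mulmx_sumr summxE. Qed.

Lemma dot_row (R : realType) (m d : nat) (A : 'M[R]_(m, d)) (x : 'cV[R]_d) i :
  dot (row i A) x = (A *m x) i 0.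
Proof. by rewrite /dot -row_mul mxE. Qed.

(** Applying [c] to an affine relation leaves the coefficient of [g] times [dot c g - delta], so
    that coefficient vanishes and only a relation among the [p i] remains. Every dimension count
    below adds a point off a hyperplane in this way. *)
Lemma affinely_independent_extend (R : realType) (d k : nat)
    (p : 'I_k -> 'cV[R]_d) (c : 'rV[R]_d) (delta : R) (g : 'cV[R]_d) :
  affinely_independent p -> (forall i, dot c (p i) = delta) ->
  dot c g != delta ->
  affinely_independent (fun i : 'I_k.+1 => oapp p g (unlift ord0 i)).
Proof.
move=> indp cp cg l; rewrite !big_ord_recl unlift_none /= => sl.
under eq_bigr do rewrite liftK /=.
move=> slp; have l0 : l ord0 = 0.
  have := congr1 (dot c) slp; rewrite dotD dotZ dot_sum.
  under eq_bigr do rewrite dotZ cp.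
  rewrite -mulr_suml /dot mulmx0 [RHS]mxE -/(dot c g) => H.
  have : l ord0 * (dot c g - delta) = 0.
    by rewrite -[RHS]H; move: sl => /eqP; rewrite addr_eq0 => /eqP ->; ring.
  by move/eqP; rewrite mulf_eq0 subr_eq0 (negPf cg) orbF => /eqP.
move: sl slp; rewrite l0 scale0r !add0r => sl slp i.
have [j ->|->//] := unliftP ord0 i.
exact: (indp (fun j => l (lift ord0 j))).
Qed.

Lemma extend_in (R : realType) (d k : nat) (p : 'I_k -> 'cV[R]_d)
    (g : 'cV[R]_d) (S : set 'cV[R]_d) :
  (forall i, S (p i)) -> S g ->
  forall i : 'I_k.+1, S (oapp p g (unlift ord0 i)).
Proof. by move=> Sp Sg i; case: (unlift ord0 i). Qed.

(** Prefixing each point with a coordinate 1 turns affine independence into linear independence of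
    rows of length [d.+1]. *)
Lemma affinely_independent_leq (R : realType) (d k : nat)
    (p : 'I_k -> 'cV[R]_d) : affinely_independent p -> (k <= d.+1)%N.
Proof.
move=> indp; pose M := \matrix_(i < k) row_mx (1 : 'M[R]_1) (p i)^T.
suff /eqP <- : row_free M by exact: (rank_leq_col M).
rewrite -kermx_eq0; apply/rowV0P => u /sub_kermxP uM.
have := uM; rewrite mulmx_sum_row => uM'.
have eqs : \sum_i u 0 i *: row_mx (1 : 'M[R]_1) (p i)^T = 0.
  by rewrite -[RHS]uM'; apply: eq_bigr => i _; rewrite rowK.
have s0 : \sum_i u 0 i = 0.
  have := congr1 (fun A => lsubmx A 0 0) eqs.
  rewrite linear_sum summxE linear0 mxE => H; rewrite -[RHS]H.
  by apply: eq_bigr => i _; rewrite linearZ /= row_mxKl !mxE eqxx mulr1.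
have s1 : \sum_i u 0 i *: p i = 0.
  have := congr1 (fun A => (rsubmx A)^T) eqs.
  rewrite !linear_sum /= !linear0 => H; rewrite -[RHS]H.
  by apply: eq_bigr => i _; rewrite !linearZ /= row_mxKr trmxK.
by apply/rowP => i; rewrite mxE; apply: (indp (fun i => u 0 i)).
Qed.

(** Serves to build a full set of independent points of a facet around a point [q], with [V] a basis
    of the directions of its hyperplane. *)
Lemma affinely_independent_frame (R : realType) (d r : nat) (q : 'cV[R]_d)
    (V : 'M[R]_(r, d)) (e : R) :
  row_free V -> e != 0 ->
  affinely_independent
    (fun i : 'I_r.+1 => oapp (fun l => q + e *: (row l V)^T) q (unlift ord0 i)).
Proof.
move=> freeV e0 l; rewrite !big_ord_recl unlift_none /= => sl.
under eq_bigr do rewrite liftK /= scalerDr scalerA.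
rewrite big_split /= -scaler_suml addrA -scalerDl sl scale0r add0r => slV.
have l0 i : l (lift ord0 i) = 0.
  have : (\row_j (l (lift ord0 j) * e)) *m V = 0.
    rewrite mulmx_sum_row -[RHS]trmx0 -slV linear_sum /=.
    by apply: eq_bigr => j _; rewrite mxE linearZ /= trmxK.
  rewrite -[RHS](mul0mx _ V) => /(row_free_inj freeV) /rowP /(_ i).
  by rewrite !mxE => /eqP; rewrite mulf_eq0 (negPf e0) orbF => /eqP.
move=> i; have [j ->//|->] := unliftP ord0 i.
by move: sl; rewrite big1 ?addr0.
Qed.

Lemma hyperplane_basis (R : realType) (d : nat) (c : 'rV[R]_d.+1) : c != 0 ->
  exists2 V : 'M[R]_(d, d.+1), row_free V & forall l, dot c (row l V)^T = 0.
Proof.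
move=> c0; suff : exists2 V : 'M[R]_(\rank (kermx c^T), d.+1),
    row_free V & forall l, dot c (row l V)^T = 0.
  by rewrite mxrank_ker mxrank_tr rank_rV c0 subn1.
exists (row_base (kermx c^T)); first exact: row_base_free.
move=> l; rewrite /dot -[c in c *m _]trmxK -trmx_mul mxE.
set r := row l _; have /sub_kermxP -> : (r <= kermx c^T)%MS.
  by rewrite (submx_trans (row_sub _ _)) // eq_row_base.
by rewrite mxE.
Qed.

(** * Facets of a polyhedron against the rows of a description *)

Lemma exists_small (R : realType) (T : finType) (alpha beta : T -> R) :
  exists2 e : R, 0 < e & forall i, 0 < alpha i -> e * beta i < alpha i.
Proof.
(* This sum dominates each ratio [beta i / alpha i] with [alpha i] positive, so [(1 + s)^-1] is
   small enough for all of them at once. *)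
pose s := \sum_(i | 0 < alpha i) `|beta i| / alpha i.
have s0 : 0 <= s by apply: sumr_ge0 => i ai; rewrite divr_ge0 // ltW.
have s1 : 0 < 1 + s by rewrite ltr_pwDl.
exists (1 + s)^-1; first by rewrite invr_gt0.
move=> i ai; rewrite mulrC ltr_pdivrMr // -ltr_pdivrMl // mulrC.
have : `|beta i| / alpha i <= s.
  rewrite /s (bigD1 i) //= lerDl; apply: sumr_ge0 => j /andP[aj _].
  by rewrite divr_ge0 // ltW.
have : beta i / alpha i <= `|beta i| / alpha i.
  by rewrite ler_pM2r ?invr_gt0 // ler_norm.
lra.
Qed.

Definition barycenter (R : realType) (d : nat) (T : finType)
    (u : T -> 'cV[R]_d) : 'cV[R]_d := #|T|%:R^-1 *: \sum_i u i.

(** The slack of the barycenter is the mean of the slacks; the next three lemmas read off its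
    sign. *)
Lemma dot_barycenter (R : realType) (d : nat) (T : finType)
    (u : T -> 'cV[R]_d) (c : 'rV[R]_d) (delta : R) : (0 < #|T|)%N ->
  delta - dot c (barycenter u) = #|T|%:R^-1 * \sum_i (delta - dot c (u i)).
Proof.
move=> T0; rewrite dotZ dot_sum sumrB sumr_const mulrBr -[delta *+ _]mulr_natr mulrCA.
by rewrite mulVf ?mulr1 // pnatr_eq0 -lt0n.
Qed.

Lemma barycenter_le (R : realType) (d : nat) (T : finType)
    (u : T -> 'cV[R]_d) (c : 'rV[R]_d) (delta : R) : (0 < #|T|)%N ->
  (forall i, dot c (u i) <= delta) -> dot c (barycenter u) <= delta.
Proof.
move=> T0 ud; rewrite -subr_ge0 dot_barycenter // mulr_ge0 ?invr_ge0 //.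
by apply: sumr_ge0 => i _; rewrite subr_ge0.
Qed.

Lemma barycenter_lt (R : realType) (d : nat) (T : finType)
    (u : T -> 'cV[R]_d) (c : 'rV[R]_d) (delta : R) i0 :
  (forall i, dot c (u i) <= delta) -> dot c (u i0) < delta ->
  dot c (barycenter u) < delta.
Proof.
move=> ud ui0; have T0 : (0 < #|T|)%N by apply/card_gt0P; exists i0.
rewrite -subr_gt0 dot_barycenter // mulr_gt0 ?invr_gt0 ?ltr0n //.
rewrite (bigD1 i0) //= ltr_pwDl ?subr_gt0 //.
by apply: sumr_ge0 => i _; rewrite subr_ge0.
Qed.

Lemma barycenter_eq (R : realType) (d : nat) (T : finType)
    (u : T -> 'cV[R]_d) (c : 'rV[R]_d) (delta : R) : (0 < #|T|)%N ->
  (forall i, dot c (u i) = delta) -> dot c (barycenter u) = delta.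
Proof.
move=> T0 ud; apply/eqP; rewrite eq_sym -subr_eq0 dot_barycenter //.
by rewrite big1 ?mulr0 // => i _; rewrite ud subrr.
Qed.

(* Were every row either slack at some point of the facet or an implicit
   equation of the polyhedron, one could leave the facet from the barycenter of
   a maximal independent family in the direction opposite to the polyhedron. *)
Lemma facet_row (R : realType) (m d : nat) (A : 'M[R]_(m, d)) (b : 'cV[R]_m)
    (F : set 'cV[R]_d) :
  let P := [set x : 'cV[R]_d | forall i, (A *m x) i 0 <= b i 0] in
  facet P F -> exists i, F = P `&` [set x : 'cV[R]_d | (A *m x) i 0 = b i 0].
Proof.
move=> P [[c [delta [cP Fdef]]]] [k [[[p [Fp indp]] maxF] [[r [Pr indr]] maxP]]].
have FP x : F x -> P x by rewrite Fdef => -[].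
have Fc x : F x -> dot c x = delta by rewrite Fdef => -[].
(* Otherwise the [k.+2] independent points [r] of [P] would all lie in [F], whose dimension is only
   [k]. *)
have [x Px cx] : exists2 x, P x & dot c x < delta.
  apply: contrapT => H; suff /(maxF _ r) /(_ indr) : forall i, F (r i).
    by rewrite ltnn.
  move=> i; rewrite Fdef; split=> //=; apply/eqP; rewrite eq_le cP //=.
  by rewrite leNgt; apply/negP => ?; apply: H; exists (r i).
pose z := barycenter p.
have card0 : (0 < #|'I_k.+1|)%N by rewrite card_ord.
have Pz i : dot (row i A) z <= b i 0.
  by apply: barycenter_le => // j; rewrite dot_row; exact: (FP _ (Fp j)).
have cz : dot c z = delta by apply: barycenter_eq => // j; exact: Fc.
have [i [pi [x' Px' x'i]]] : exists i, (forall j, dot (row i A) (p j) = b i 0)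
    /\ exists2 x', P x' & dot (row i A) x' != b i 0.
  apply: contrapT => H.
  (* The step [e] is short enough to respect every row that is slack at [z]; the rows tight at [z]
     are tight at all [p j], hence at [x], and do not change along [z - x]. *)
  have [e e0 eP] := exists_small (fun i => b i 0 - dot (row i A) z)
    (fun i => dot (row i A) z - dot (row i A) x).
  suff /cP : P (z + e *: (z - x)).
    rewrite -/(dot c _) dotD dotZ dotB cz => /le_trans; apply: contraPP => _.
    move=> /(_ _ (lexx _)); rewrite -subr_ge0 opprD addrA subrr sub0r oppr_ge0.
    by rewrite leNgt mulr_gt0 // subr_gt0.
  move=> i; rewrite -dot_row dotD dotZ dotB.
  have [zi|] := ltP (dot (row i A) z) (b i 0).
    by have := eP i; rewrite subr_gt0 => /(_ zi) /ltW; rewrite lerBrDl.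
  move=> zi; have zbi : dot (row i A) z = b i 0.
    by apply/eqP; rewrite eq_le Pz zi.
  have pi j : dot (row i A) (p j) = b i 0.
    apply/eqP; rewrite eq_le {1}dot_row (FP _ (Fp j)) /= leNgt; apply/negP => lt.
    have : dot (row i A) z < b i 0.
      by apply: (barycenter_lt _ lt) => l; rewrite dot_row; exact: (FP _ (Fp l)).
    by rewrite zbi ltxx.
  have xi : dot (row i A) x = b i 0.
    apply/eqP/negPn/negP => xi; apply: H; exists i; split=> //.
    by exists x.
  by rewrite xi zbi subrr mulr0 addr0.
(* A point of [F] off the row would give [k.+2] independent points in [F]. A point [g] of [P] on the
   row but outside [F] would give [k.+3] in [P]: the [p j], then [g], separated by [c], then [x'],
   separated by the row. *)
exists i; apply/seteqP; split=> [f Ff|g [Pg gi]].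
  split; first exact: FP.
  rewrite /= -dot_row; apply/eqP/negPn/negP => fi.
  have := maxF _ _ (extend_in Fp Ff) (affinely_independent_extend indp pi fi).
  by rewrite ltnn.
rewrite Fdef; split=> //=; apply/eqP/negPn/negP; rewrite -/(dot c g) => cg.
have indg := affinely_independent_extend indp (fun j => Fc _ (Fp j)) cg.
have Pg' := extend_in (fun j => FP _ (Fp j)) Pg.
have gi' j : dot (row i A) (oapp p g (unlift ord0 j)) = b i 0.
  by case: (unlift ord0 j) => [j'|] /=; rewrite ?pi // dot_row.
have := maxP _ _ (extend_in Pg' Px') (affinely_independent_extend indg gi' x'i).
by rewrite ltnn.
Qed.

(** By [facet_row], every facet is the tight set of some row, so the rows map onto a superset of the
    facets. *)
Lemma card_facets_le (R : realType) (m d : nat) (A : 'M[R]_(m, d))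
    (b : 'cV[R]_m) :
  let P := [set x : 'cV[R]_d | forall i, (A *m x) i 0 <= b i 0] in
  exists2 k, (k <= m)%N & ([set F | facet P F] #= `I_k)%card.
Proof.
move=> P; pose G i := P `&` [set x : 'cV[R]_d | (A *m x) i 0 = b i 0].
have le : ([set F | facet P F] #<= `I_m)%card.
  apply: (@card_le_trans _ _ _ [set: 'I_m]); last first.
    by have /card_eqPle[] := @card_II m.
  apply: card_le_trans (card_image_le G [set: 'I_m]); apply: subset_card_le.
  by move=> F /facet_row[i ->]; exists i.
have /finite_setP[k Pk] := card_le_finite le (finite_II m).
by exists k; rewrite // -card_le_II -(card_le_eql Pk).
Qed.

(* S is a minimal subsystem: dropping row i admits a point w violating only
   that row, and the segment from z to w leaves the polyhedron at a point where
   row i alone is tight. *)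
Lemma irredundant_rows_facets (R : realType) (m d : nat) (A : 'M[R]_(m, d.+1))
    (b : 'cV[R]_m) (z : 'cV[R]_d.+1) (k : nat) :
  let P := [set x : 'cV[R]_d.+1 | forall i, (A *m x) i 0 <= b i 0] in
  P z -> (forall i, row i A != 0 -> (A *m z) i 0 < b i 0) ->
  ([set F | facet P F] #= `I_k)%card ->
  exists2 S : {set 'I_m}, (#|S| <= k)%N &
    forall x, ~ P x -> exists2 i, i \in S & b i 0 < (A *m x) i 0.
Proof.
move=> P Pz zlt cardP.
pose suff_rows (S : {set 'I_m}) :=
  `[< forall x, (forall i, i \in S -> (A *m x) i 0 <= b i 0) -> P x >].
have fullT : suff_rows [set: 'I_m]%SET.
  by apply/asboolP => x xT i; apply: xT; rewrite inE.
have [S /minsetP[/asboolP SP Smin] _] := minset_exists fullT.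
have out i : i \in S -> exists2 w : 'cV[R]_d.+1,
    (forall j, j \in S -> j != i -> (A *m w) j 0 <= b j 0) &
    b i 0 < (A *m w) i 0.
  move=> iS; apply: contrapT => H.
  suff /Smin /(_ (subD1set _ _)) /setP /(_ i) : suff_rows (S :\ i).
    by rewrite !inE eqxx iS.
  apply/asboolP => x xS; apply: SP => j jS.
  have [->|ji] := eqVneq j i; last by apply: xS; rewrite !inE ji.
  rewrite leNgt; apply/negP => xi; apply: H; exists x => // l lS li.
  by apply: xS; rewrite !inE li.
(* A zero row in [S] would read [0 <= b i 0], which holds because [z] is in [P], so no [w] could
   violate it. *)
have zS i : i \in S -> dot (row i A) z < b i 0.
  move=> iS; rewrite dot_row; apply: zlt; apply/eqP => r0.
  have [w _] := out i iS; have := Pz i; rewrite -!dot_row r0 /dot !mul0mx.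
  by move=> /le_lt_trans /[apply]; rewrite ltxx.
have wit i : i \in S -> exists q : 'cV[R]_d.+1, dot (row i A) q = b i 0 /\
    forall j, j \in S -> j != i -> dot (row j A) q < b j 0.
  move=> iS; have [w wS] := out i iS; rewrite -dot_row => wi.
  have zi := zS i iS.
  have D0 : 0 < dot (row i A) w - dot (row i A) z by lra.
  pose t := (b i 0 - dot (row i A) z) / (dot (row i A) w - dot (row i A) z).
  have t0 : 0 < t by rewrite divr_gt0 // subr_gt0.
  have t1 : t < 1 by rewrite ltr_pdivrMr // mul1r; lra.
  exists (z + t *: (w - z)); split.
    by rewrite dotD dotZ dotB divfK ?gt_eqF //; ring.
  move=> j jS ji; rewrite dotD dotZ dotB.
  have := zS j jS; have := wS j jS ji; rewrite -dot_row; nra.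
(* Outside [S] the chosen point is the dummy value 0. *)
have /boolp.choice[q qP] : forall i, exists q : 'cV[R]_d.+1, i \in S ->
    dot (row i A) q = b i 0 /\
    forall j, j \in S -> j != i -> dot (row j A) q < b j 0.
  by move=> i; have [/wit [q ?]|_] := boolP (i \in S); [exists q | exists 0].
pose G i := P `&` [set x : 'cV[R]_d.+1 | dot (row i A) x = b i 0].
have Pq i : i \in S -> P (q i).
  move=> /qP [qi qj]; apply: SP => j jS; rewrite -dot_row.
  by have [->|/qj] := eqVneq j i; rewrite ?qi // => /(_ jS) /ltW.
have facetG i : i \in S -> facet P (G i).
  move=> iS; split.
    by exists (row i A), (b i 0); split=> // x Px; rewrite -/(dot _ _) dot_row.
  have rowi0 : row i A != 0.
    apply/eqP => r0; have := zS i iS; have [w _] := out i iS.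
    have := Pz i; rewrite -!dot_row r0 /dot !mul0mx.
    by move=> /le_lt_trans /[apply]; rewrite ltxx.
  have [V freeV aV] := hyperplane_basis rowi0.
  (* Indexing by pairs gives one step length that suits all rows [j] and all basis directions [l] of
     the hyperplane of row [i]. *)
  have [e e0 eP] := exists_small
    (fun jl : 'I_m * 'I_d => b jl.1 0 - dot (row jl.1 A) (q i))
    (fun jl => dot (row jl.1 A) (row jl.2 V)^T).
  have [qi qj] := qP i iS.
  have Gq l : G i (q i + e *: (row l V)^T).
    split; last by rewrite /= dotD dotZ aV mulr0 addr0.
    apply: SP => j jS; rewrite -dot_row dotD dotZ.
    have [->|ji] := eqVneq j i; first by rewrite aV mulr0 addr0 qi.
    have /= := eP (j, l); rewrite subr_gt0 => /(_ (qj j jS ji)) /ltW.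
    by rewrite lerBrDl.
  have Gqi : G i (q i) by split=> //; apply: Pq.
  have ind := @affinely_independent_frame _ _ _ (q i) _ _ freeV (lt0r_neq0 e0).
  have inG := extend_in Gq Gqi.
  have zi : dot (row i A) z != b i 0 by rewrite lt_eqF ?zS.
  (* The [d.+1] points of the frame show that the facet has dimension at least [d], and adding [z]
     gives dimension [d.+1] for [P]. Conversely, an independent family in the facet stays
     independent with [z] added, so it has at most [d.+1] members. *)
  exists d; split; split.
  - by eexists; split; [exact: inG | exact: ind].
  - move=> r p Gp indp.
    have := affinely_independent_extend indp (fun j => (Gp j).2) zi.
    by move=> /affinely_independent_leq.
  - have indz := affinely_independent_extend ind (fun j => (inG j).2) zi.
    by eexists; split; [exact: (extend_in (fun j => (inG j).1) Pz) | exact: indz].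
  - by move=> r p _ /affinely_independent_leq.
exists S => [|x nPx]; last first.
  apply: contrapT => H; apply: nPx; apply: SP => i iS.
  by rewrite leNgt; apply/negP => ?; apply: H; exists i.
rewrite -card_le_II -(card_le_eqr cardP).
(* Distinct rows of [S] give distinct facets: [q] of one row is strictly slack for every other row
   of [S]. *)
have [f] : $|{injfun [set: 'I_#|S|] >-> [set F | facet P F]}|.
  apply/injfunPex; exists (fun j => G (enum_val j)).
    by move=> j _; apply: facetG; exact: enum_valP.
  move=> j l _ _ eqG; apply/enum_val_inj/eqP/negPn/negP => jl.
  have [qj qj'] := qP _ (enum_valP j).
  have : G (enum_val l) (q (enum_val j)).
    by rewrite -eqG; split=> //; apply/Pq/enum_valP.
  move=> [_ /= ql]; have := qj' _ (enum_valP l); rewrite eq_sym ql ltxx.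
  by move=> /(_ jl).
apply: card_le_trans (inj_card_le f).
by have /card_eqPle[] := @card_II #|S|.
Qed.

(** * Vertices of the cube, parity, and membership in a relaxation *)

Lemma convex_polyhedron (R : realType) (d : nat) (P : set 'cV[R]_d) :
  polyhedron P -> @convex_set R 'cV[R]_d P.
Proof.
move=> [m [A [b ->]]] x y l; rewrite !inE => Px Py i.
have -> : x <| l |> y =
    l%:num *: (x : 'cV[R]_d) + (1 - l%:num) *: (y : 'cV[R]_d).
  by [].
rewrite -dot_row dotD !dotZ !dot_row.
have := Px i; have := Py i; have : 0 <= l%:num by []; have : l%:num <= 1 by [].
by rewrite /=; nra.
Qed.

Definition chi (T : pzSemiRingType) (n : nat) (Y : {set 'I_n}) : 'cV[T]_n :=
  \col_i (i \in Y)%:R.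
Arguments chi : clear implicits.

Lemma map_chi (R : realType) (n : nat) (Y : {set 'I_n}) :
  map_mx intr (chi int n Y) = chi R n Y.
Proof. by apply/colP => i; rewrite !mxE; case: (i \in Y). Qed.

Lemma sum_chi (n : nat) (Y : {set 'I_n}) :
  \sum_i chi int n Y i 0 = #|Y|%:Z.
Proof.
rewrite -natz -sum1_card natr_sum [RHS]big_mkcond /=.
by apply: eq_bigr => i _; rewrite mxE; case: (i \in Y).
Qed.

Lemma EVEN_chi (n : nat) (x : 'cV[int]_n) :
  EVEN n x <-> exists2 Y : {set 'I_n}, ~~ odd #|Y| & x = chi int n Y.
Proof.
have even Y : (2 %| \sum_i chi int n Y i 0)%Z = ~~ odd #|Y|.
  by rewrite sum_chi -dvdn2.
split=> [[x01 xeven]|[Y evenY ->]]; last first.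
  by split; rewrite ?even // => i; rewrite mxE; case: (i \in Y); [right|left].
have xE : x = chi int n [set i | x i 0 == 1]%SET.
  by apply/colP => i; rewrite mxE inE; case: (x01 i) => ->.
by exists [set i | x i 0 == 1]%SET; rewrite // -even -xE.
Qed.

Definition flip (n : nat) (i : 'I_n) (Y : {set 'I_n}) : {set 'I_n} :=
  [set j | (j \in Y) (+) (j == i)]%SET.

Lemma odd_flip (n : nat) (i : 'I_n) (Y : {set 'I_n}) :
  odd #|flip i Y| = ~~ odd #|Y|.
Proof.
have [iY|iY] := boolP (i \in Y).
  have -> : flip i Y = (Y :\ i)%SET.
    by apply/setP => j; rewrite !inE; case: eqP => [->|_]; rewrite ?iY ?addbF.
  by rewrite [in RHS](cardsD1 i) iY /= negbK.
have -> : flip i Y = (i |: Y)%SET.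
  apply/setP => j; rewrite !inE; case: eqP => [->|_]; rewrite ?addbF //.
  by rewrite (negPf iY).
by rewrite cardsU1 iY.
Qed.

Lemma flipK (n : nat) (i : 'I_n) : involutive (flip i).
Proof. by move=> Y; apply/setP => j; rewrite !inE addbK. Qed.

(* The hiding-set property: two distinct odd vertices have the same midpoint as
   two even ones. *)
Lemma chi_add_flip (R : realType) (n : nat) (i : 'I_n) (Y Z : {set 'I_n}) :
  (i \in Y) != (i \in Z) ->
  chi R n Y + chi R n Z = chi R n (flip i Y) + chi R n (flip i Z).
Proof.
move=> iYZ; apply/colP => j; rewrite !mxE !inE.
have [->|_] := eqVneq j i; rewrite ?addbF //.
by move: iYZ; case: (i \in Y); case: (i \in Z) => //= _; rewrite addrC.
Qed.

(* The Hamming distance to Y is x |-> #|Y| - dot (cut Y) x. *)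
Definition cut (R : realType) (n : nat) (Y : {set 'I_n}) : 'rV[R]_n :=
  \row_i (if i \in Y then 1 else -1).
Arguments cut : clear implicits.

Lemma cut_chi (R : realType) (n : nat) (Y Z : {set 'I_n}) :
  dot (cut R n Y) (chi R n Z) = #|Y|%:R - #|(Y :\: Z) :|: (Z :\: Y)|%:R.
Proof.
rewrite /dot mxE -!sum1_card !natr_sum.
rewrite [X in _ = X - _]big_mkcond [X in _ = _ - X]big_mkcond /= -sumrB.
apply: eq_bigr => i _; rewrite !mxE !inE.
by case: (i \in Y); case: (i \in Z) => /=; ring.
Qed.

Lemma cut_chi_eq (R : realType) (n : nat) (Y : {set 'I_n}) :
  dot (cut R n Y) (chi R n Y) = #|Y|%:R.
Proof. by rewrite cut_chi finset.setDv finset.setU0 cards0 subr0. Qed.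

Lemma cut_chi_neq (R : realType) (n : nat) (Y Z : {set 'I_n}) :
  Y != Z -> dot (cut R n Y) (chi R n Z) <= #|Y|%:R - 1.
Proof.
move=> YZ; rewrite cut_chi lerB // ler1n card_gt0; apply: contraNneq YZ => D0.
apply/eqP/setP => i; have /setP /(_ i) := D0.
by rewrite !inE; case: (i \in Y); case: (i \in Z).
Qed.

Lemma polyhedron_hull (R : realType) (n : nat) (X : set 'cV[int]_n)
    (P : set 'cV[R]_n) : polyhedron P -> map_mx intr @` X `<=` P ->
  convex_hull (map_mx intr @` X) `<=` P.
Proof. by move=> /convex_polyhedron convP XP; apply: smallest_sub. Qed.

Lemma relaxation_even (R : realType) (n : nat) (P : set 'cV[R]_n)
    (Y : {set 'I_n}) : relaxation (EVEN n) P -> ~~ odd #|Y| -> P (chi R n Y).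
Proof.
move=> [_ PE] evenY; suff : (P `&` integer_points R n) (chi R n Y) by case.
rewrite PE; split; last by exists (chi int n Y); rewrite ?map_chi.
apply: sub_gen_smallest; exists (chi int n Y); rewrite ?map_chi //.
by apply/EVEN_chi; exists Y.
Qed.

(** The half-space [H] keeping distance at least 1 from [Y] contains every even vertex, hence their
    hull, but not [Y] itself. *)
Lemma relaxation_odd (R : realType) (n : nat) (P : set 'cV[R]_n)
    (Y : {set 'I_n}) : relaxation (EVEN n) P -> odd #|Y| -> ~ P (chi R n Y).
Proof.
move=> [_ PE] oddY PY; have : (P `&` integer_points R n) (chi R n Y).
  by split=> //; exists (chi int n Y); rewrite ?map_chi.
rewrite PE => -[+ _].
pose H := [set x : 'cV[R]_n | forall i : 'I_1,
  (cut R n Y *m x) i 0 <= (\col__ (#|Y|%:R - 1) : 'cV[R]_1) i 0].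
have Hpoly : polyhedron H by exists 1%N, (cut R n Y), (\col__ (#|Y|%:R - 1)).
move=> /(polyhedron_hull Hpoly) HY; have : H (chi R n Y).
  apply: HY => _ [x /EVEN_chi[Z evenZ ->] <-] i; rewrite map_chi ord1 [leRHS]mxE.
  apply: cut_chi_neq; apply: contraTneq oddY => ->; exact: evenZ.
move=> /(_ 0); rewrite [leRHS]mxE -/(dot _ _) cut_chi_eq; lra.
Qed.

(** * Lower bound on the number of facets *)

(** A row tight at 0 and at all sums of two distinct unit vectors has [b l 0 = 0] and pairwise
    opposite coefficients. Three coordinates then force the row to be zero, whence the dimension
    [n.+3]. *)
Lemma EVEN_interior (R : realType) (n : nat) (m : nat) (A : 'M[R]_(m, n.+3))
    (b : 'cV[R]_m) :
  let P := [set x : 'cV[R]_n.+3 | forall i, (A *m x) i 0 <= b i 0] in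
  relaxation (EVEN n.+3) P ->
  exists2 z : 'cV[R]_n.+3, P z & forall i, row i A != 0 -> (A *m z) i 0 < b i 0.
Proof.
(* Flipping twice from the empty set covers both kinds of even points: the origin when the indices
   agree, a sum of two unit vectors otherwise. *)
move=> P relP; pose u (ij : 'I_n.+3 * 'I_n.+3) :=
  chi R n.+3 (flip ij.1 (flip ij.2 finset.set0)).
have Pu ij : P (u ij).
  by apply: relaxation_even; rewrite // !odd_flip cards0.
have Pu' l ij : dot (row l A) (u ij) <= b l 0 by rewrite dot_row Pu.
have uij i j : i != j -> u (i, j) = delta_mx i 0 + delta_mx j 0.
  move=> ij; apply/colP => l; rewrite !mxE !inE /= !andbT.
  have [->|li] := eqVneq l i; last by rewrite addbF add0r.
  by rewrite (negPf ij) addr0.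
have uii i : u (i, i) = 0 by apply/colP => l; rewrite /u /= flipK !mxE inE.
exists (barycenter u).
  by move=> l; rewrite -dot_row; apply: barycenter_le; rewrite ?card_prod ?card_ord.
move=> l rl; rewrite -dot_row.
have [[ij uijl]|H] := pselect (exists ij, dot (row l A) (u ij) < b l 0).
  by apply: barycenter_lt uijl => ?; exact: Pu'.
have ub ij : dot (row l A) (u ij) = b l 0.
  apply/eqP; rewrite eq_le Pu' leNgt; apply/negP => ?; apply: H; by exists ij.
have b0 : b l 0 = 0 by rewrite -(ub (ord0, ord0)) uii /dot mulmx0 mxE.
pose a i := A l i.
have dota i : dot (row l A) (delta_mx i 0) = a i.
  by rewrite dot_row -colE mxE.
have aa i j : i != j -> a i + a j = 0.
  by move=> ij; rewrite -!dota -dotD -uij // ub.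
case/negP: rl; apply/eqP/rowP => i; rewrite !mxE -/(a i).
have [j [k [ij ik jk]]] : exists j k : 'I_n.+3, [/\ i != j, i != k & j != k].
  case: i => [[|[|i]] Hi].
  - by exists (inord 1), (inord 2); split; rewrite -val_eqE /= !inordK.
  - by exists (inord 0), (inord 2); split; rewrite -val_eqE /= !inordK.
  - by exists (inord 0), (inord 1); split; rewrite -val_eqE /= !inordK.
have := aa _ _ ij; have := aa _ _ ik; have := aa _ _ jk; lra.
Qed.

Lemma relaxation_EVEN_lower (R : realType) (n : nat) (P : set 'cV[R]_n.+3)
    (k : nat) :
  relaxation (EVEN n.+3) P -> ([set F | facet P F] #= `I_k)%card ->
  (2 ^ n.+3 <= k * 2)%N.
Proof.
move=> relP cardP; have [[m [A [b PE]]] _] := relP.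
rewrite PE in relP cardP.
have [z Pz zlt] := EVEN_interior relP.
have [S Sk Sviol] := irredundant_rows_facets Pz zlt cardP.
(* Sending every subset to an odd one avoids counting the odd subsets: all subsets are counted, each
   odd one being reached twice. *)
pose o (Y : {set 'I_n.+3}) := if odd #|Y| then Y else flip (ord0 : 'I_n.+3) Y.
have oo Y : odd #|o Y| by rewrite /o; case: ifP => // oY; rewrite odd_flip oY.
have /boolp.choice[f fP] : forall Y : {set 'I_n.+3}, exists i, i \in S /\
    b i 0 < dot (row i A) (chi R n.+3 (o Y)).
  move=> Y; have [i iS] := Sviol _ (relaxation_odd relP (oo Y)).
  by rewrite -dot_row => lt; exists i.
(* If [o Y] and [o Z] differ at [i], flipping [i] in both gives even vertices with the same sum,
   which satisfy the row that both odd vertices violate. *)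
have finj Y Z : f Y = f Z -> o Y = o Z.
  move=> fYZ; apply/setP => i; apply/eqP/negPn/negP => iYZ.
  have [_ ltY] := fP Y; have [_ ltZ] := fP Z.
  have le (W : {set 'I_n.+3}) : odd #|W| ->
      dot (row (f Y) A) (chi R n.+3 (flip i W)) <= b (f Y) 0.
    move=> oW; have eW : ~~ odd #|flip i W| by rewrite odd_flip oW.
    by rewrite dot_row (relaxation_even relP eW).
  have := le _ (oo Y); have := le _ (oo Z); rewrite -fYZ in ltZ.
  have := congr1 (dot (row (f Y) A)) (chi_add_flip R iYZ); rewrite !dotD.
  lra.
(* The parity of [Y] tells which of the two preimages of [o Y] it is; this is the factor 2 in the
   bound. *)
have ginj : injective (fun Y : {set 'I_n.+3} => (f Y, odd #|Y|)).
  move=> Y Z [/finj + YZ]; rewrite /o YZ; case: ifP => // _.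
  exact: (can_inj (flipK ord0)).
have -> : (2 ^ n.+3 = #|{: {set 'I_n.+3}}|)%N.
  by rewrite -cardsT -powersetT card_powerset cardsT card_ord.
rewrite -(card_imset _ ginj); apply: (@leq_trans #|finset.setX S [set: bool]%SET|).
  apply/subset_leq_card/fintype.subsetP => _ /finset.imsetP[Y _ ->].
  by rewrite !inE andbT; case: (fP Y).
by rewrite cardsX cardsT card_bool leq_mul2r Sk.
Qed.

(** * An explicit relaxation for the upper bound *)

Lemma EVEN_relaxation (R : realType) (n : nat) :
  exists (m : nat) (A : 'M[R]_(m, n)) (b : 'cV[R]_m),
    (m <= 3 * 2 ^ n)%N /\
    relaxation (EVEN n) [set x : 'cV[R]_n | forall i, (A *m x) i 0 <= b i 0].
Proof.
pose T := ('I_n + ('I_n + {set 'I_n}))%type.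
(* The rows are [x i 0 <= 1], [- x i 0 <= 0] and the cuts at odd vertices; an even [Y] contributes
   the trivial row [0 <= 0], which keeps the index type plain. *)
pose a (t : T) : 'rV[R]_n := match t with
  | inl i => delta_mx 0 i | inr (inl i) => - delta_mx 0 i
  | inr (inr Y) => if odd #|Y| then cut R n Y else 0 end.
pose c (t : T) : R := match t with
  | inl i => 1 | inr (inl i) => 0
  | inr (inr Y) => if odd #|Y| then #|Y|%:R - 1 else 0 end.
pose A := \matrix_(i < #|{: T}|) a (enum_val i).
pose b := \col_(i < #|{: T}|) c (enum_val i).
exists #|{: T}|, A, b; split.
  rewrite !card_sum -(cardsT {set 'I_n}) -powersetT card_powerset cardsT !card_ord.
  (* There are [2 * n + 2 ^ n] rows, and [n < 2 ^ n]. *)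
  have := ltn_expl n (isT : (1 < 2)%N); lia.
set P := [set x | _].
have PE x : P x <-> forall t, dot (a t) x <= c t.
  have At i : (A *m x) i 0 = dot (a (enum_val i)) x by rewrite -dot_row rowK.
  split=> [Px t|Px i]; last by rewrite At mxE.
  by have := Px (enum_rank t); rewrite At mxE enum_rankK.
have dotdelta i (x : 'cV[R]_n) : dot (delta_mx 0 i) x = x i 0.
  by rewrite /dot -rowE mxE.
have dotNdelta i (x : 'cV[R]_n) : dot (- delta_mx 0 i) x = - x i 0.
  by rewrite -dotdelta /dot mulNmx mxE.
have polyP : polyhedron P by exists #|{: T}|, A, b.
have EP : map_mx intr @` EVEN n `<=` P.
  move=> _ [x /EVEN_chi[Y evenY ->] <-]; rewrite map_chi; apply/PE.
  move=> [i|[i|Z]] /=.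
  - by rewrite dotdelta mxE; case: (i \in Y).
  - by rewrite dotNdelta mxE oppr_le0; case: (i \in Y).
  - case: ifP => oZ; last by rewrite /dot mul0mx mxE.
    by apply: cut_chi_neq; apply/eqP => ZY; rewrite -ZY oZ in evenY.
split=> //; apply/seteqP; split=> [y [Py [x _ xy]]|x [hx ix]]; last first.
  by split=> //; apply: polyhedron_hull hx.
move: Py; rewrite -{y}xy => /PE Px; split; last by exists x.
(* Integrality enters here: an integer between 0 and 1 is one of the two. *)
have x01 i : x i 0 = 0 \/ x i 0 = 1.
  have := Px (inl i); have := Px (inr (inl i)); rewrite /= dotdelta dotNdelta.
  rewrite mxE oppr_le0 ler0z lerz1; lia.
pose Y := [set i | x i 0 == 1]%SET.
have xY : x = chi int n Y.
  by apply/colP => i; rewrite mxE inE; case: (x01 i) => ->.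
apply: sub_gen_smallest; exists x => //; apply/EVEN_chi; exists Y => //.
apply/negP => oY; have := Px (inr (inr Y)).
rewrite /= oY xY map_chi cut_chi_eq; lra.
Qed.

(** * From facet counts to the asymptotic statement *)

Lemma rc_EVEN_bounds (R : realType) (n : nat) : (2 < n)%N ->
  2^-1 * 2 ^+ n <= fine (rc R (EVEN n)) <= 3 * 2 ^+ n.
Proof.
case: n => [//|[//|[//|n]]] _.
have lb : ((2^-1 * 2 ^+ n.+3)%:E <= rc R (EVEN n.+3))%E.
  apply: le_ereal_inf_tmp => _ [k [P [relP cardP]] <-].
  have := relaxation_EVEN_lower relP cardP.
  rewrite lee_fin -(ler_nat R) natrM natrX; lra.
have ub : (rc R (EVEN n.+3) <= (3 * 2 ^+ n.+3)%:E)%E.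
  have [m [A [b [mle relP]]]] := EVEN_relaxation R n.+3.
  have [k km cardP] := card_facets_le A b.
  apply: (@le_trans _ _ (k%:R)%:E).
    by apply: ereal_inf_lbound; exists k => //; eexists; split; eassumption.
  by rewrite lee_fin -natrX -natrM ler_nat (leq_trans km).
(* Finiteness is what makes [fine] faithful: [lb] excludes minus infinity and [ub] plus infinity. *)
have fin : rc R (EVEN n.+3) \is a fin_num.
  by rewrite fin_numE; apply/andP; split; apply/eqP => E; rewrite E in lb ub.
by rewrite -!lee_fin fineK // lb ub.
Qed.

(* fine maps +oo to 0, which the lower bound of Theta excludes for large n. *)
Theorem theorem7 (R : realType) :
  (fun n : nat => fine (rc R (EVEN n)) : R^o)
    =Theta_\oo (fun n : nat => 2 ^+ n : R^o).
Proof.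
rewrite eqThetaE qualifE; apply/asboolP; exists (2^-1, 3) => /=.
  by rewrite invr_gt0 !ltr0n.
(* The threshold 3 is the dimension from which [rc_EVEN_bounds] applies. *)
exists 3%N => // n /= n3; have /andP[lb ub] := rc_EVEN_bounds R n3.
have p0 : 0 <= 2 ^+ n :> R by rewrite exprn_ge0.
rewrite (ger0_norm p0) ger0_norm //.
by apply: le_trans lb; rewrite mulr_ge0 // invr_ge0.
Qed.
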